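(* Let $a\in\mathbb{R}^m$, $b\in\mathbb{R}^n$ be probability vectors, and put $$\alpha_1=\max_{1\le i\le m}\frac{a_i}{n},\quad \beta_1=\max_{1\le i\le m}a_i,\quad \alpha_2=\max_{1\le j\le n}\frac{b_j}{m},\quad \beta_2=\max_{1\le j\le n}b_j .$$ Let $(i_1,j_1),\dots,(i_k,j_k)$ be index pairs in $\{1,\dots,m\}\times\{1,\dots,n\}$ such that $i_1,\dots,i_k$ are pairwise distinct and $j_1,\dots,j_k$ are pairwise distinct, and let $\varphi\in\mathbb{R}^{m\times n}$. Then $$g(x,\varphi)\ \ge\ \begin{cases} L_1(x,\varphi,a), & \text{for all } x \text{ with } \alpha_1\le x\le\beta_1,\\ L_2(x,\varphi,b), & \text{for all } x \text{ with } \alpha_2\le x\le\beta_2,\end{cases}$$ where $$L_1(x,\varphi,a)=\sum_{\ell=1}^k\nu\bigl(x,\{\varphi_{i_\ell q}\}_{q\in\{1,\dots,n\}\setminus\{j_\ell\}},a_{i_\ell}\bigr)+\sum_{p\notin\{i_1,\dots,i_k\}}\mu\bigl(x,\{\varphi_{pq}\}_{q\in\{1,\dots,n\}},a_p\bigr),$$ $$L_2(x,\varphi,b)=\sum_{\ell=1}^k\nu\bigl(x,\{\varphi_{pj_\ell}\}_{p\in\{1,\dots,m\}\setminus\{i_\ell\}},b_{j_\ell}\bigr)+\sum_{q\notin\{j_1,\dots,j_k\}}\mu\bigl(x,\{\varphi_{pq}\}_{p\in\{1,\dots,m\}},b_q\bigr).$$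
   Context: $U(a,b)=\{\Pi\in\mathbb{R}^{m\times n}_+:\Pi\mathbf{1}_n=a,\ \Pi^T\mathbf{1}_m=b\}$. $V=(\{1,\dots,m\}\times\{1,\dots,n\})\setminus\{(i_\ell,j_\ell)\}_{\ell=1}^k$ and $O=\{X\in\mathbb{R}^{m\times n}_+:X_{i_kj_k}\ge\cdots\ge X_{i_1j_1}\ge X_{pq}\ \forall(p,q)\in V\}$. For $x\in\mathbb{R}$, $$g(x,\varphi)=\min\Bigl\{\sum_{(p,q)\in V}\Pi_{pq}\varphi_{pq}\ :\ \Pi\in U(a,b)\cap O,\ \Pi_{i_\ell j_\ell}=x\ \text{for all }\ell\in\{1,\dots,k\}\Bigr\}.$$ For a finite family of reals $\{\varphi_i\}_{i\in I}$ and reals $u,\alpha$, $\mathrm{PACKING}(\{\varphi_i\}_{i\in I},u,\alpha)$ is the optimal value of $$\min_{x\in\mathbb{R}^I}\sum_{i\in I}\varphi_ix_i\quad\text{s.t.}\quad\sum_{i\in I}x_i=\alpha,\quad 0\le x_i\le u\ (i\in I).$$ Define $\mu(u,\{\varphi_i\}_{i\in I},\alpha)=\mathrm{PACKING}(\{\varphi_i\}_{i\in I},u,\alpha)$ and $\nu(u,\{\varphi_i\}_{i\in I},\alpha)=\mathrm{PACKING}(\{\varphi_i\}_{i\in I},u,\alpha-u)$. A minimum over an empty feasible set is $+\infty$. *)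

(* Defs.v *)
From HB Require Import structures.
From mathcomp Require Import all_boot all_order all_algebra.
From mathcomp Require Import all_classical all_reals ereal.

Set Implicit Arguments.
Unset Strict Implicit.
Unset Printing Implicit Defensive.

Import Order.TTheory GRing.Theory Num.Theory.

Local Open Scope classical_set_scope.
Local Open Scope ring_scope.

Section Defs.
Context {R : realType}.

Definition probability_vector (m : nat) (a : 'cV[R]_m) : Prop :=
  (forall p, 0 <= a p 0) /\ \sum_p a p 0 = 1.

Definition nonneg_mx (m n : nat) (X : 'M[R]_(m, n)) : Prop :=
  forall p q, 0 <= X p q.

Definition Uset (m n : nat) (a : 'cV[R]_m) (b : 'cV[R]_n) : set 'M[R]_(m, n) :=
  [set Pi | [/\ nonneg_mx Pi,
               Pi *m const_mx 1 = a & Pi^T *m const_mx 1 = b]].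

(* Lists of index pairs (i_1, j_1), ..., (i_k, j_k) are nonempty (the set Oset
   refers to (i_1, j_1)): they are given by two functions on 'I_k.+1, and
   (i_1, j_1) is (i ord0, j ord0). *)
Definition Vset (m n k : nat) (i : 'I_k.+1 -> 'I_m) (j : 'I_k.+1 -> 'I_n) :
    {set 'I_m * 'I_n} :=
  (~: [set (i l, j l) | l : 'I_k.+1])%SET.

Definition Oset (m n k : nat) (i : 'I_k.+1 -> 'I_m) (j : 'I_k.+1 -> 'I_n) :
    set 'M[R]_(m, n) :=
  [set X | [/\ nonneg_mx X,
              forall l l' : 'I_k.+1,
                (l <= l')%N -> X (i l) (j l) <= X (i l') (j l')
            & forall p q, (p, q) \in Vset i j -> X p q <= X (i ord0) (j ord0)]].

(* Optimal values of minimization problems are infima in the extended reals,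
   so that the value is +oo when there is no feasible point. The feasible sets
   of g and packing are compact and their objectives continuous, hence the
   infimum is a minimum whenever the problem is feasible; in particular no
   optimal value is -oo and the extended sums in L1 and L2 are unambiguous. *)
Definition g (m n k : nat) (a : 'cV[R]_m) (b : 'cV[R]_n)
    (i : 'I_k.+1 -> 'I_m) (j : 'I_k.+1 -> 'I_n)
    (x : R) (phi : 'M[R]_(m, n)) : \bar R :=
  ereal_inf [set (\sum_(pq in Vset i j) Pi pq.1 pq.2 * phi pq.1 pq.2)%:E
            | Pi in Uset a b `&` Oset i j
                    `&` [set Pi | forall l, Pi (i l) (j l) = x]].

Definition packing (I : finType) (phi : I -> R) (u alpha : R) : \bar R :=
  ereal_inf [set (\sum_t phi t * x t)%:E
            | x in [set x : I -> R | \sum_t x t = alpha /\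
                                     forall t, 0 <= x t <= u]].

Definition mu (u : R) (I : finType) (phi : I -> R) (alpha : R) : \bar R :=
  packing phi u alpha.

Definition nu (u : R) (I : finType) (phi : I -> R) (alpha : R) : \bar R :=
  packing phi u (alpha - u).

Definition L1 (m n k : nat) (i : 'I_k.+1 -> 'I_m) (j : 'I_k.+1 -> 'I_n)
    (x : R) (phi : 'M[R]_(m, n)) (a : 'cV[R]_m) : \bar R :=
  (\sum_(l < k.+1)
      nu x (fun q : {q : 'I_n | q != j l} => phi (i l) (val q)) (a (i l) 0%R)
   + \sum_(p < m | p \notin codom i)
      mu x (fun q : 'I_n => phi p q) (a p 0%R))%E.

Definition L2 (m n k : nat) (i : 'I_k.+1 -> 'I_m) (j : 'I_k.+1 -> 'I_n)
    (x : R) (phi : 'M[R]_(m, n)) (b : 'cV[R]_n) : \bar R :=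
  (\sum_(l < k.+1)
      nu x (fun p : {p : 'I_m | p != i l} => phi (val p) (j l)) (b (j l) 0%R)
   + \sum_(q < n | q \notin codom j)
      mu x (fun p : 'I_m => phi p q) (b q 0%R))%E.

End Defs.

(* Main.v *)
(** Fix a feasible [Pi]. The order constraints bound every entry of [Pi] by the
    common value [x], so each row of [Pi] is feasible for a packing problem: a
    row [p] outside the [i l] for the one defining [mu], and the row [i l] with
    its entry [x] in column [j l] deleted for the one defining [nu]. Since [i]
    is injective, the objective of [g] is the sum of the objectives of these
    packing problems. The bound by columns follows by transposition. *)
Require Import Defs.
From HB Require Import structures.
From mathcomp Require Import all_boot all_order all_algebra.
From mathcomp Require Import all_classical all_reals ereal.

Set Implicit Arguments.
Unset Strict Implicit.

Import Order.TTheory GRing.Theory Num.Theory.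

Local Open Scope ring_scope.

Lemma packing_le (R : realType) (I : finType) (phi y : I -> R) (u alpha : R) :
  \sum_t y t = alpha -> (forall t, 0 <= y t <= u) ->
  (packing phi u alpha <= (\sum_t phi t * y t)%:E)%E.
Proof. by move=> sum_y y_bnd; apply: ereal_inf_lbound; exists y. Qed.

(** Needed because the packing problems behind [nu] are indexed by a subtype, while the objective of
    [g] yields filtered sums. *)
Lemma sum_sig_neq (R : nmodType) (I : finType) (t0 : I) (F : I -> R) :
  \sum_(t : {t | t != t0}) F (val t) = \sum_(t | t != t0) F t.
Proof. by rewrite -(big_sub [pred t | t != t0]). Qed.

Lemma sum_codom (R : nmodType) (I J : finType) (h : I -> J) (F : J -> R) :
  injective h -> \sum_(t in codom h) F t = \sum_s F (h s).
Proof.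
move=> h_inj; rewrite -(big_imset F (in2W h_inj)); apply: eq_bigl => t.
by apply/codomP/imsetP => [[s ->]|[s _ ->]]; exists s.
Qed.

Lemma mem_Vset (m n k : nat) (i : 'I_k.+1 -> 'I_m) (j : 'I_k.+1 -> 'I_n) p q :
  ((p, q) \in Vset i j) = [forall l, (p, q) != (i l, j l)].
Proof.
rewrite inE -negb_exists; congr (~~ _).
by apply/imsetP/existsP => [[l _ ->]|[l /eqP ->]]; exists l.
Qed.

Lemma mem_Vset_tr (m n k : nat) (i : 'I_k.+1 -> 'I_m) (j : 'I_k.+1 -> 'I_n) p q :
  ((q, p) \in Vset j i) = ((p, q) \in Vset i j).
Proof. by rewrite !mem_Vset; apply: eq_forallb => l; rewrite !xpair_eqE andbC. Qed.

(** Splitting by rows: since [i] is injective, row [i l] loses only its entry in column [j l]; a row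
    outside the image of [i] loses nothing. *)
Lemma sum_Vset (R : nmodType) (m n k : nat) (i : 'I_k.+1 -> 'I_m)
    (j : 'I_k.+1 -> 'I_n) (F : 'I_m -> 'I_n -> R) :
  injective i ->
  \sum_(pq in Vset i j) F pq.1 pq.2 =
  \sum_l \sum_(q | q != j l) F (i l) q + \sum_(p | p \notin codom i) \sum_q F p q.
Proof.
move=> i_inj.
rewrite (eq_bigl (fun pq => (pq.1, pq.2) \in Vset i j)); last by case.
rewrite -(pair_big_dep xpredT (fun p q => (p, q) \in Vset i j)) /=.
rewrite (bigID [in codom i]) /= sum_codom //; congr (_ + _).
  apply: eq_bigr => l _; apply: eq_bigl => q; rewrite mem_Vset.
  apply/forallP/idP => [/(_ l)|q_neq l']; rewrite xpair_eqE.
    by rewrite eqxx.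
  (* Only the pair with [l' = l] lies in row [i l], and there the columns differ. *)
  by case: eqP => [/i_inj <-|].
apply: eq_bigr => p p_i; apply: eq_bigl => q; rewrite mem_Vset.
apply/forallP => l; rewrite xpair_eqE; case: eqP => // p_eq.
by rewrite p_eq codom_f in p_i.
Qed.

(** Entries on [Vset] are dominated by the entry at [ord0], which is [x]; all other entries equal
    [x] by the extra constraint in [g]. *)
Lemma Oset_le (R : realType) (m n k : nat) (i : 'I_k.+1 -> 'I_m)
    (j : 'I_k.+1 -> 'I_n) (x : R) (Pi : 'M[R]_(m, n)) :
  Oset i j Pi -> (forall l, Pi (i l) (j l) = x) -> forall p q, Pi p q <= x.
Proof.
move=> [_ _ Pi_V] Pi_ij p q.
have [pqV|] := boolP ((p, q) \in Vset i j); first by rewrite -(Pi_ij ord0) Pi_V.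
by rewrite mem_Vset negb_forall => /existsP[l /negPn/eqP[-> ->]]; rewrite Pi_ij.
Qed.

Lemma L1_le_g (R : realType) (m n k : nat) (a : 'cV[R]_m) (b : 'cV[R]_n)
    (i : 'I_k.+1 -> 'I_m) (j : 'I_k.+1 -> 'I_n) (x : R) (phi : 'M[R]_(m, n)) :
  injective i -> (L1 i j x phi a <= g a b i j x phi)%E.
Proof.
move=> i_inj; apply: le_ereal_inf_tmp => _ [Pi [[[Pi_ge0 Pi_a _] Pi_O] Pi_ij] <-].
have Pi_bnd p q : 0 <= Pi p q <= x by rewrite Pi_ge0 (Oset_le Pi_O Pi_ij).
have Pi_row p : \sum_q Pi p q = a p 0.
  by rewrite -Pi_a mxE; apply: eq_bigr => q _; rewrite mxE mulr1.
rewrite (sum_Vset j (fun p q => Pi p q * phi p q) i_inj) EFinD -!sumEFin.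
apply: leeD; [apply: lee_sum => l _|apply: lee_sum => p _].
  under eq_bigr do rewrite mulrC.
  rewrite -(sum_sig_neq (j l) (fun q => phi (i l) q * Pi (i l) q)).
  apply: (@packing_le _ _ _ (fun t => Pi (i l) (val t))) => //.
  (* The mass left in row [i l] is its total minus the deleted entry [x], which is the shifted total
     [alpha - u] of [nu]. *)
  rewrite (sum_sig_neq (j l) (Pi (i l))) -(Pi_row (i l)).
  by rewrite [in RHS](bigD1 (j l)) //= Pi_ij addrAC subrr add0r.
by under eq_bigr do rewrite mulrC; apply: packing_le.
Qed.

(** Transposition swaps the two marginals, preserves the order constraints and keeps the objective,
    so each value attained on the right is also attained on the left. *)
Lemma g_tr_le (R : realType) (m n k : nat) (a : 'cV[R]_m) (b : 'cV[R]_n)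
    (i : 'I_k.+1 -> 'I_m) (j : 'I_k.+1 -> 'I_n) (x : R) (phi : 'M[R]_(m, n)) :
  (g b a j i x phi^T <= g a b i j x phi)%E.
Proof.
apply: le_ereal_inf_tmp => _ [Pi [[[Pi_ge0 Pi_a Pi_b] [_ Pi_mono Pi_V]] Pi_ij] <-].
apply: ereal_inf_lbound; exists Pi^T.
  have PiT_ge0 : nonneg_mx Pi^T by move=> q p; rewrite mxE.
  split; first split.
  - by split; rewrite ?trmxK.
  - split=> // [l l' /Pi_mono|q p]; rewrite !mxE // mem_Vset_tr.
    exact: Pi_V.
  - by move=> l; rewrite mxE.
congr (_%:E); rewrite (reindex (fun pq : 'I_m * 'I_n => (pq.2, pq.1))) /=.
  by apply: eq_big => -[p q] /=; [exact: mem_Vset_tr|rewrite !mxE].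
by exists (fun qp => (qp.2, qp.1)) => -[].
Qed.

Lemma L2_tr (R : realType) (m n k : nat) (b : 'cV[R]_n)
    (i : 'I_k.+1 -> 'I_m) (j : 'I_k.+1 -> 'I_n) (x : R) (phi : 'M[R]_(m, n)) :
  L2 i j x phi b = L1 j i x phi^T b.
Proof.
congr (_ + _)%E; apply: eq_bigr => ? _.
  by congr (nu _ _ _); apply/funext => ?; rewrite mxE.
by congr (mu _ _ _); apply/funext => ?; rewrite mxE.
Qed.

Theorem proposition4p1 (R : realType) (m n k : nat)
    (a : 'cV[R]_m) (b : 'cV[R]_n)
    (i : 'I_k.+1 -> 'I_m) (j : 'I_k.+1 -> 'I_n) (phi : 'M[R]_(m, n)) :
  probability_vector a -> probability_vector b ->
  injective i -> injective j ->
  let alpha1 := \big[Num.max/0]_(p < m) (a p 0 / n%:R) in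
  let beta1 := \big[Num.max/0]_(p < m) a p 0 in
  let alpha2 := \big[Num.max/0]_(q < n) (b q 0 / m%:R) in
  let beta2 := \big[Num.max/0]_(q < n) b q 0 in
  (forall x : R, alpha1 <= x <= beta1 ->
     (L1 i j x phi a <= g a b i j x phi)%E) /\
  (forall x : R, alpha2 <= x <= beta2 ->
     (L2 i j x phi b <= g a b i j x phi)%E).
Proof.
move=> _ _ i_inj j_inj /=; split=> x _; first exact: L1_le_g.
(* The row bound is applied to the transposed problem, where injectivity of [j] takes the place of
   that of [i]. *)
by rewrite L2_tr; apply: le_trans (g_tr_le _ _ _ _ _ _); apply: L1_le_g.
Qed.
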